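(* Let $\omega_1,\omega_2\in\mathbb C$ be nonzero with $\omega_1/\omega_2\notin\mathbb R$, and let $\Lambda=\{a\omega_1+b\omega_2: a,b\in\mathbb Z\}$. The Weierstrass function $$\wp(z)=\frac{1}{z^2}+\sum_{\omega\in\Lambda\setminus\{0\}}\left(\frac{1}{(z+\omega)^2}-\frac{1}{\omega^2}\right)$$ is an elliptic function on $\Lambda$, with a double pole at each lattice point $\omega\in\Lambda$ and no poles anywhere else. Furthermore, $\wp$ is an even function.
   Context: A meromorphic function $f$ on $\mathbb C$ is called elliptic on $\Lambda$ if $f(z+\omega_1)=f(z+\omega_2)=f(z)$ for all $z\in\mathbb C$. *)

(* Defs.v *)
From Stdlib Require Import Reals ZArith List ClassicalEpsilon.
From Coquelicot Require Import Coquelicot.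

Open Scope C_scope.

(** The series over the lattice carries no order of summation, so it is an
    unordered sum: the limit of the finite partial sums along the directed
    family of finite subsets of [D], a finite subset being represented by a
    duplicate-free list. *)
Definition finite_subset (D : C -> Prop) (S : list C) : Prop :=
  NoDup S /\ (forall w, In w S -> D w).

Definition finite_subsets (D : C -> Prop) : (list C -> Prop) -> Prop :=
  fun P => exists S0, finite_subset D S0 /\
    forall S, finite_subset D S -> incl S0 S -> P S.

Definition finite_sum (f : C -> C) (S : list C) : C :=
  fold_right Cplus 0 (map f S).

Definition is_usum (D : C -> Prop) (f : C -> C) (l : C) : Prop :=
  filterlim (finite_sum f) (finite_subsets D) (locally l).

Definition ex_usum (D : C -> Prop) (f : C -> C) : Prop :=
  exists l, is_usum D f l.

(** Meaningful only under [ex_usum D f]. *)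
Definition usum (D : C -> Prop) (f : C -> C) : C :=
  iota (T := C_CompleteNormedModule) (is_usum D f).

(** A meromorphic function takes its values in C together with the point at
    infinity, [None], which is its value exactly at its poles. *)
Definition sphere : Type := option C.
Definition infty : sphere := None.
Definition finite (z : C) : sphere := Some z.

(** [ex_derive] is here complex differentiability: [C] is taken as a normed
    module over itself. *)
Definition holomorphic_near (g : C -> C) (z0 : C) : Prop :=
  locally z0 (fun z => ex_derive g z).

Definition holomorphic_at (f : C -> sphere) (z0 : C) : Prop :=
  exists g : C -> C, holomorphic_near g z0 /\
    locally z0 (fun z => f z = finite (g z)).

(** This constrains [f] only on a punctured neighbourhood of [z0]. *)
Definition pole_of_order (n : nat) (f : C -> sphere) (z0 : C) : Prop :=
  (1 <= n)%nat /\
  exists g : C -> C, holomorphic_near g z0 /\ g z0 <> 0 /\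
    locally' z0 (fun z => f z = finite (g z / (z - z0) ^ n)).

Definition pole (f : C -> sphere) (z0 : C) : Prop :=
  exists n : nat, pole_of_order n f z0.

Definition meromorphic (f : C -> sphere) : Prop :=
  forall z0, holomorphic_at f z0 \/ (pole f z0 /\ f z0 = infty).

Definition elliptic (w1 w2 : C) (f : C -> sphere) : Prop :=
  meromorphic f /\ (forall z, f (z + w1) = f z /\ f (z + w2) = f z).

Definition lattice (w1 w2 : C) (w : C) : Prop :=
  exists a b : Z, w = RtoC (IZR a) * w1 + RtoC (IZR b) * w2.

Definition lattice_nonzero (w1 w2 : C) (w : C) : Prop :=
  lattice w1 w2 w /\ w <> 0.

Definition wp_term (z w : C) : C := 1 / (z + w) ^ 2 - 1 / w ^ 2.

(** At a lattice point some denominator [z ^ 2] or [(z + w) ^ 2] vanishes; the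
    convention there is 1 / 0 = infinity, instead of Coquelicot's [/ 0 = 0]. *)
Definition wp (w1 w2 : C) (z : C) : sphere :=
  if excluded_middle_informative (lattice w1 w2 z) then infty
  else finite (1 / z ^ 2 + usum (lattice_nonzero w1 w2) (wp_term z)).

(* Main.v *)
Require Import Defs.
From Stdlib Require Import Reals ZArith List Permutation Classical ClassicalEpsilon Lra Lia Psatz.
From Coquelicot Require Import Coquelicot.

(** With Coquelicot's [/ 0 = 0] the term of index [0] is [1 / z ^ 2], so [wp] is
    the unordered sum of [1 / (z + w) ^ 2 - 1 / w ^ 2] over the whole lattice.
    Everything rests on the convergence of the sum of [1 / (1 + |w|) ^ 3], which
    is dominated by a product of two one-dimensional sums.  It dominates the
    differences [1 / (z + w) ^ 2 - 1 / (y + w) ^ 2] and the second-order Taylor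
    remainders of [1 / (z + w) ^ 2], so the sum over the indices [w] for which
    [- w] stays away from [z] converges and is differentiable at [z]; at a
    lattice point [p] the single index [- p] is split off and gives the double
    pole.  For periodicity, [wp z - wp y] is a sum over the lattice that is
    unchanged when [z] and [y] are both translated by a period [v]; taking
    [y = - v / 2], evenness gives [wp (y + v) = wp y]. *)

Open Scope R_scope.

(** * Unordered sums *)

Lemma locally_Cmod (P : C -> Prop) (z : C) :
  locally z P <-> exists d, 0 < d /\ forall y, Cmod (y - z) < d -> P y.
Proof.
  split.
  - intros H. apply locally_C in H. destruct H as [d Hd].
    exists d; split; [apply cond_pos | exact Hd].
  - intros [d [Hd H]]. apply locally_C. exists (mkposreal d Hd). exact H.
Qed.

(** Splits a larger finite set into a smaller one and a remainder. Comparisons of partial sums and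
    the Cauchy estimate reduce to bounding the sum over the remainder [U]. *)
Lemma incl_NoDup_Permutation {A} (S T : list A) :
  NoDup S -> incl S T -> exists U, Permutation T (S ++ U).
Proof.
  induction S as [|a S IH]; intros HS HST.
  - exists T; apply Permutation_refl.
  - inversion HS as [|? ? Ha HS']; subst.
    destruct IH as [U HU]; [assumption | intros x Hx; apply HST; now right |].
    assert (HaU : In a U).
    { assert (H : In a (S ++ U)) by (apply (Permutation_in a HU), HST; now left).
      apply in_app_or in H; tauto. }
    apply in_split in HaU. destruct HaU as [U1 [U2 ->]].
    exists (U1 ++ U2). rewrite HU. simpl.
    rewrite (app_assoc S U1), (app_assoc S U1).
    apply Permutation_sym, Permutation_middle.
Qed.

Definition rsum {A} (F : A -> R) (S : list A) : R := fold_right Rplus 0 (map F S).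

Lemma rsum_cons {A} (F : A -> R) a S : rsum F (a :: S) = F a + rsum F S.
Proof. reflexivity. Qed.

Lemma rsum_app {A} (F : A -> R) S T : rsum F (S ++ T) = rsum F S + rsum F T.
Proof.
  induction S as [|a S IH]; simpl; [unfold rsum at 2; simpl; lra|].
  rewrite !rsum_cons, IH; lra.
Qed.

Lemma rsum_Permutation {A} (F : A -> R) S T : Permutation S T -> rsum F S = rsum F T.
Proof. induction 1; rewrite ?rsum_cons in *; lra. Qed.

Lemma rsum_map {A B} (F : B -> R) (g : A -> B) S :
  rsum F (map g S) = rsum (fun a => F (g a)) S.
Proof. unfold rsum; now rewrite map_map. Qed.

Lemma rsum_scal {A} (F : A -> R) c S : rsum (fun a => c * F a) S = c * rsum F S.
Proof.
  induction S as [|a S IH]; [unfold rsum; simpl; lra|].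
  rewrite !rsum_cons, IH; lra.
Qed.

Lemma rsum_ge_0 {A} (F : A -> R) S : (forall a, 0 <= F a) -> 0 <= rsum F S.
Proof.
  intros HF; induction S as [|a S IH]; [unfold rsum; simpl; lra|].
  rewrite rsum_cons; specialize (HF a); lra.
Qed.

Lemma rsum_le {A} (F G : A -> R) S :
  (forall a, In a S -> F a <= G a) -> rsum F S <= rsum G S.
Proof.
  induction S as [|a S IH]; intros H; [unfold rsum; simpl; lra|].
  rewrite !rsum_cons.
  apply Rplus_le_compat; [apply H; now left | apply IH; intros; apply H; now right].
Qed.

Lemma rsum_incl {A} (F : A -> R) S T :
  (forall a, 0 <= F a) -> NoDup S -> incl S T -> rsum F S <= rsum F T.
Proof.
  intros HF HS HST. destruct (incl_NoDup_Permutation S T HS HST) as [U HU].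
  rewrite (rsum_Permutation F _ _ HU), rsum_app.
  generalize (rsum_ge_0 F U HF); lra.
Qed.

Lemma rsum_list_prod {A B} (F : A -> R) (G : B -> R) S T :
  rsum (fun p => F (fst p) * G (snd p)) (list_prod S T) = rsum F S * rsum G T.
Proof.
  induction S as [|a S IH]; [unfold rsum; simpl; lra|].
  simpl. rewrite rsum_app, IH, rsum_map, rsum_cons. simpl.
  rewrite rsum_scal. lra.
Qed.

Lemma finite_sum_cons f a S : finite_sum f (a :: S) = (f a + finite_sum f S)%C.
Proof. reflexivity. Qed.

Lemma finite_sum_app f S T :
  finite_sum f (S ++ T) = (finite_sum f S + finite_sum f T)%C.
Proof.
  induction S as [|a S IH]; simpl; [unfold finite_sum at 2; simpl; ring|].
  rewrite !finite_sum_cons, IH; ring.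
Qed.

Lemma finite_sum_Permutation f S T :
  Permutation S T -> finite_sum f S = finite_sum f T.
Proof.
  induction 1; rewrite ?finite_sum_cons in *; try congruence; ring.
Qed.

Lemma finite_sum_minus f g S :
  finite_sum (fun w => f w - g w)%C S = (finite_sum f S - finite_sum g S)%C.
Proof.
  induction S as [|a S IH]; [unfold finite_sum; simpl; ring|].
  rewrite !finite_sum_cons, IH; ring.
Qed.

Lemma finite_sum_scal c f S :
  finite_sum (fun w => c * f w)%C S = (c * finite_sum f S)%C.
Proof.
  induction S as [|a S IH]; [unfold finite_sum; simpl; ring|].
  rewrite !finite_sum_cons, IH; ring.
Qed.

Lemma finite_sum_ext f g S :
  (forall w, In w S -> f w = g w) -> finite_sum f S = finite_sum g S.
Proof.
  intros H; unfold finite_sum; f_equal; now apply map_ext_in.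
Qed.

Lemma Cmod_finite_sum f S : Cmod (finite_sum f S) <= rsum (fun w => Cmod (f w)) S.
Proof.
  induction S as [|a S IH]; [unfold finite_sum, rsum; simpl; rewrite Cmod_0; lra|].
  rewrite finite_sum_cons, rsum_cons.
  eapply Rle_trans; [apply Cmod_triangle | lra].
Qed.

Lemma finite_subset_union D S T :
  finite_subset D S -> finite_subset D T ->
  exists U, finite_subset D U /\ incl S U /\ incl T U.
Proof.
  intros [_ HS] [_ HT]. exists (nodup Ceq_dec (S ++ T)). repeat split.
  - apply NoDup_nodup.
  - intros w Hw. apply nodup_In, in_app_or in Hw. destruct Hw; auto.
  - intros w Hw. apply nodup_In, in_or_app; auto.
  - intros w Hw. apply nodup_In, in_or_app; auto.
Qed.

Lemma finite_subset_nil D : finite_subset D nil.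
Proof. split; [constructor | intros w []]. Qed.

#[local] Instance finite_subsets_proper D : ProperFilter (finite_subsets D).
Proof.
  split.
  - intros P [S [HS H]]. exists S. apply H; [assumption | apply incl_refl].
  - split.
    + exists nil; split; [apply finite_subset_nil | trivial].
    + intros P Q [S [HS HP]] [T [HT HQ]].
      destruct (finite_subset_union D S T HS HT) as [U [HU [HSU HTU]]].
      exists U; split; [assumption|]. intros V HV HUV.
      split; [apply HP | apply HQ]; auto; eapply incl_tran; eauto.
    + intros P Q HPQ [S [HS HP]]. exists S; auto.
Qed.

Lemma is_usumE D f l :
  is_usum D f l <->
  forall eps, 0 < eps -> exists S0, finite_subset D S0 /\
    forall S, finite_subset D S -> incl S0 S -> Cmod (finite_sum f S - l) < eps.
Proof.
  split.
  - intros H eps Heps.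
    apply (H (fun y => Cmod (y - l) < eps)).
    apply locally_Cmod. exists eps; auto.
  - intros H P HP. apply locally_Cmod in HP. destruct HP as [d [Hd HP]].
    destruct (H d Hd) as [S0 [HS0 HS]]. exists S0; auto.
Qed.

(** Estimates are made on finite sums only, and this carries them to the limit: some finite sum lies
    within any [eps] of [l]. *)
Lemma is_usum_bound D f l M :
  is_usum D f l ->
  (forall S, finite_subset D S -> Cmod (finite_sum f S) <= M) -> Cmod l <= M.
Proof.
  intros Hl HM. rewrite is_usumE in Hl. apply le_epsilon. intros eps Heps.
  destruct (Hl eps Heps) as [S [HS H]].
  specialize (H S HS (incl_refl S)). specialize (HM S HS).
  replace l with (finite_sum f S + - (finite_sum f S - l))%C by ring.
  eapply Rle_trans; [apply Cmod_triangle|]. rewrite Cmod_opp. lra.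
Qed.

Lemma is_usum_ext D f g l :
  (forall w, D w -> f w = g w) -> is_usum D f l -> is_usum D g l.
Proof.
  intros Hfg. rewrite !is_usumE. intros H eps Heps.
  destruct (H eps Heps) as [S0 [HS0 HS]]. exists S0; split; [assumption|].
  intros S HSD Hincl. rewrite <- (finite_sum_ext f g); [auto|].
  intros w Hw; apply Hfg, HSD, Hw.
Qed.

Lemma is_usum_minus D f g l m :
  is_usum D f l -> is_usum D g m -> is_usum D (fun w => f w - g w)%C (l - m)%C.
Proof.
  rewrite !is_usumE. intros Hf Hg eps Heps.
  destruct (Hf (eps / 2)) as [S [HS Hf']]; [lra|].
  destruct (Hg (eps / 2)) as [T [HT Hg']]; [lra|].
  destruct (finite_subset_union D S T HS HT) as [U [HU [HSU HTU]]].
  exists U; split; [assumption|]. intros V HV HUV.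
  specialize (Hf' V HV (incl_tran HSU HUV)). specialize (Hg' V HV (incl_tran HTU HUV)).
  rewrite finite_sum_minus.
  replace (finite_sum f V - finite_sum g V - (l - m))%C
    with ((finite_sum f V - l) + - (finite_sum g V - m))%C by ring.
  eapply Rle_lt_trans; [apply Cmod_triangle|]. rewrite Cmod_opp. lra.
Qed.

Lemma is_usum_scal D c f l :
  is_usum D f l -> is_usum D (fun w => c * f w)%C (c * l)%C.
Proof.
  rewrite !is_usumE. intros Hf eps Heps.
  pose proof (Cmod_ge_0 c) as Hc.
  destruct (Hf (eps / (Cmod c + 1))) as [S [HS H]]; [apply Rdiv_lt_0_compat; lra|].
  exists S; split; [assumption|]. intros V HV HSV. specialize (H V HV HSV).
  rewrite finite_sum_scal.
  replace (c * finite_sum f V - c * l)%C with (c * (finite_sum f V - l))%C by ring.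
  rewrite Cmod_mult. apply Rlt_div_r in H; [|lra].
  pose proof (Cmod_ge_0 (finite_sum f V - l)). nra.
Qed.

Lemma is_usum_unique D f l m : is_usum D f l -> is_usum D f m -> l = m.
Proof.
  intros Hl Hm. pose proof (is_usum_minus _ _ _ _ _ Hl Hm) as H.
  (* [l - m] is an unordered sum of [f - f], whose finite sums all vanish. *)
  assert (H0 : Cmod (l - m) <= 0).
  { apply (is_usum_bound _ _ _ _ H). intros S _.
    rewrite finite_sum_minus.
    replace (finite_sum f S - finite_sum f S)%C with (RtoC 0) by ring.
    rewrite Cmod_0; lra. }
  pose proof (Cmod_ge_0 (l - m)).
  apply Ceq_minus, Cmod_eq_0. lra.
Qed.

Lemma usum_unique D f l : is_usum D f l -> usum D f = l.
Proof.
  intros H. unfold usum. apply (iota_unique (V := C_CompleteNormedModule)); [|assumption].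
  intros m Hm; eapply is_usum_unique; eassumption.
Qed.

Lemma usum_correct D f : ex_usum D f -> is_usum D f (usum D f).
Proof. intros [l Hl]. now rewrite (usum_unique D f l Hl). Qed.

(** A bijection carries finite subsets to finite subsets and respects inclusion, so the two directed
    families correspond. It serves for negation (evenness) and for translation by a period. *)
Lemma is_usum_reindex (D D' : C -> Prop) (phi psi : C -> C) f l :
  (forall w, psi (phi w) = w) -> (forall w, phi (psi w) = w) ->
  (forall w, D w <-> D' (phi w)) ->
  is_usum D' f l -> is_usum D (fun w => f (phi w)) l.
Proof.
  intros Hpp Hpp' HD. rewrite !is_usumE. intros H eps Heps.
  destruct (H eps Heps) as [S [[HSn HSD] HS]].
  exists (map psi S). split.
  - split.
    + apply FinFun.Injective_map_NoDup; [|assumption].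
      intros x y Hxy. rewrite <- (Hpp' x), <- (Hpp' y), Hxy; reflexivity.
    + intros w Hw. apply in_map_iff in Hw. destruct Hw as [v [<- Hv]].
      apply HD. rewrite Hpp'. auto.
  - intros T [HTn HTD] HST.
    replace (finite_sum (fun w => f (phi w)) T) with (finite_sum f (map phi T))
      by (unfold finite_sum; now rewrite map_map).
    apply HS.
    + split.
      * apply FinFun.Injective_map_NoDup; [|assumption].
        intros x y Hxy. rewrite <- (Hpp x), <- (Hpp y), Hxy; reflexivity.
      * intros w Hw. apply in_map_iff in Hw. destruct Hw as [v [<- Hv]].
        apply HD; auto.
    + intros w Hw. apply in_map_iff. exists (psi w). split; [apply Hpp'|].
      apply HST, in_map, Hw.
Qed.

(** Once a finite subset contains [p], its sum is exactly [f p] plus a sum over a finite subset of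
    [D]. This isolates the index [0] in [wp] and the index [- p] at a pole [p]. *)
Lemma is_usum_insert (D D' : C -> Prop) p f l :
  ~ D p -> (forall w, D' w <-> w = p \/ D w) ->
  is_usum D f l -> is_usum D' f (f p + l)%C.
Proof.
  intros Hp HD. rewrite !is_usumE. intros H eps Heps.
  destruct (H eps Heps) as [S [[HSn HSD] HS]].
  exists (p :: S). split.
  - split; [constructor; auto|]. intros w [<-|Hw]; apply HD; auto.
  - intros T [HTn HTD] HST.
    assert (HpT : In p T) by (apply HST; now left).
    apply in_split in HpT. destruct HpT as [T1 [T2 ->]].
    pose proof (Permutation_middle T1 T2 p) as HP.
    pose proof (Permutation_NoDup (Permutation_sym HP) HTn) as HN.
    inversion HN as [|? ? HpT HN']; subst.
    rewrite <- (finite_sum_Permutation f _ _ HP), finite_sum_cons.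
    replace (f p + finite_sum f (T1 ++ T2) - (f p + l))%C
      with (finite_sum f (T1 ++ T2) - l)%C by ring.
    apply HS.
    + split; [assumption|]. intros w Hw.
      assert (Hw' : In w (T1 ++ p :: T2)) by (apply (Permutation_in w HP); now right).
      destruct (proj1 (HD w) (HTD w Hw')) as [->|]; [contradiction|assumption].
    + intros w Hw.
      assert (Hw' : In w (p :: T1 ++ T2))
        by (apply (Permutation_in w (Permutation_sym HP)), HST; now right).
      destruct Hw' as [<-|]; [|assumption]. exfalso; auto.
Qed.

(** Absolute convergence implies convergence. Let [m] be the supremum of the finite sums of moduli
    and [S0] a finite subset whose sum exceeds [m - eps / 2]; whatever is added to [S0] contributes
    less than [eps / 2]. Completeness of the complex numbers does the rest. *)
Lemma ex_usum_abs D f M :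
  (forall S, finite_subset D S -> rsum (fun w => Cmod (f w)) S <= M) -> ex_usum D f.
Proof.
  intros HM. set (F := fun w => Cmod (f w)) in HM.
  destruct (completeness (fun x => exists S, finite_subset D S /\ x = rsum F S))
    as [m [Hub Hlub]].
  { exists M. intros x [S [HS ->]]; auto. }
  { exists (rsum F nil), nil; split; [apply finite_subset_nil | reflexivity]. }
  apply (filterlim_locally_cauchy (U := C_CompleteNormedModule)
           (F := finite_subsets D) (finite_sum f)).
  intros eps.
  assert (He : 0 < eps / 2) by (pose proof (cond_pos eps); lra).
  assert (HS0 : exists S, finite_subset D S /\ m - eps / 2 < rsum F S).
  { apply NNPP. intros HN.
    assert (m <= m - eps / 2); [|lra].
    apply Hlub. intros x [S [HS ->]].
    destruct (Rle_lt_dec (rsum F S) (m - eps / 2)); [assumption|].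
    exfalso; apply HN; eauto. }
  destruct HS0 as [S0 [HS0 Hm]].
  assert (Hclose : forall S, finite_subset D S -> incl S0 S ->
            Cmod (finite_sum f S - finite_sum f S0) < eps / 2).
  { intros S HS Hincl.
    destruct (incl_NoDup_Permutation S0 S (proj1 HS0) Hincl) as [U HU].
    assert (HSm : rsum F S <= m) by (apply Hub; eauto).
    rewrite (rsum_Permutation F _ _ HU), rsum_app in HSm.
    rewrite (finite_sum_Permutation f _ _ HU), finite_sum_app.
    replace (finite_sum f S0 + finite_sum f U - finite_sum f S0)%C
      with (finite_sum f U) by ring.
    pose proof (Cmod_finite_sum f U) as HfU. fold F in HfU. lra. }
  exists (fun S => finite_subset D S /\ incl S0 S). split.
  - exists S0; auto.
  - intros S T [HS HS'] [HT HT'].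
    (* The balls here are those of the product uniform structure; closeness in modulus implies
       closeness in them. *)
    apply (C_NormedModule_mixin_compat1 (finite_sum f S) (finite_sum f T)).
    pose proof (Hclose S HS HS') as H1. pose proof (Hclose T HT HT') as H2.
    change (Cmod (finite_sum f T - finite_sum f S) < eps).
    replace (finite_sum f T - finite_sum f S)%C
      with ((finite_sum f T - finite_sum f S0) + - (finite_sum f S - finite_sum f S0))%C
      by ring.
    eapply Rle_lt_trans; [apply Cmod_triangle|]. rewrite Cmod_opp. lra.
Qed.

(** * Lattice sums *)

(** This is the power [-3/2] of [1 + |x|]: summable over the integers, while a product of two such
    factors, one per lattice coordinate, has total degree [-3]. *)
Definition decay (x : R) : R := / ((1 + Rabs x) * sqrt (1 + Rabs x)).

Lemma decay_ge_0 x : 0 <= decay x.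
Proof.
  pose proof (Rabs_pos x). unfold decay. apply Rlt_le, Rinv_0_lt_compat.
  apply Rmult_lt_0_compat; [lra | apply sqrt_lt_R0; lra].
Qed.

Lemma rsum_decay_nat N : rsum (fun n => decay (INR n)) (seq 0 N) <= 3.
Proof.
  (* Comparison with the telescoping differences of [2 / sqrt n]; the constant [3] makes the case of
     the single term [1] an equality. *)
  assert (H : forall n, rsum (fun n => decay (INR n)) (seq 0 (S n))
                        <= 3 - 2 / sqrt (INR (S n))).
  { induction n as [|n IH].
    - unfold rsum, decay; simpl. rewrite Rabs_R0, !Rplus_0_r, sqrt_1. lra.
    - rewrite seq_S, rsum_app. eapply Rle_trans; [apply Rplus_le_compat_r, IH|].
      simpl (0 + S n)%nat. rewrite rsum_cons. unfold rsum; simpl fold_right.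
      unfold decay. rewrite (Rabs_pos_eq (INR (S n))) by apply pos_INR.
      rewrite (S_INR (S n)), (Rplus_comm 1).
      assert (Hn : 0 < INR (S n)) by (apply lt_0_INR; lia).
      set (x := INR (S n)) in *.
      assert (Hs : 0 < sqrt x) by (apply sqrt_lt_R0; lra).
      assert (Ht : 0 < sqrt (x + 1)) by (apply sqrt_lt_R0; lra).
      assert (Es : sqrt x * sqrt x = x) by (apply sqrt_sqrt; lra).
      assert (Et : sqrt (x + 1) * sqrt (x + 1) = x + 1) by (apply sqrt_sqrt; lra).
      assert (Hst : sqrt x <= sqrt (x + 1)) by (apply sqrt_le_1; lra).
      set (s := sqrt x) in *. set (t := sqrt (x + 1)) in *.
      rewrite <- Et.
      (* Since [t * t - s * s = 1], the right side equals [2 / (s * t * (s + t))], and [s <= t]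
         bounds that denominator by [2 * t ^ 3]. *)
      assert (H : / (t * t * t) <= 2 / s - 2 / t); [|lra].
      replace (2 / s - 2 / t) with (2 * (t * t - s * s) / (s * t * (s + t)))
        by (field; repeat split; nra).
      replace (2 * (t * t - s * s)) with 2 by nra.
      apply Rle_trans with (2 / (2 * (t * t * t))).
      + right; field; lra.
      + apply Rmult_le_compat_l; [lra|]. apply Rinv_le_contravar.
        * repeat apply Rmult_lt_0_compat; lra.
        * assert (s * (s + t) <= t * (t + t)) by nra. nra. }
  destruct N as [|N]; [unfold rsum; simpl; lra|].
  eapply Rle_trans; [apply H|].
  assert (0 < 2 / sqrt (INR (S N))); [|lra].
  apply Rdiv_lt_0_compat; [lra|]. apply sqrt_lt_R0, lt_0_INR; lia.
Qed.

(* Lists [0] twice, which is harmless for upper bounds. *)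
Definition Zbox (N : nat) : list Z :=
  map Z.of_nat (seq 0 N) ++ map (fun n => - Z.of_nat n)%Z (seq 0 N).

Lemma in_Zbox N a : (Z.abs a < Z.of_nat N)%Z -> In a (Zbox N).
Proof.
  intros H. apply in_or_app. destruct (Z_le_gt_dec 0 a).
  - left. apply in_map_iff. exists (Z.to_nat a). split; [lia|]. apply in_seq; lia.
  - right. apply in_map_iff. exists (Z.to_nat (- a)). split; [lia|]. apply in_seq; lia.
Qed.

Lemma rsum_decay_Zbox N : rsum (fun a => decay (IZR a)) (Zbox N) <= 6.
Proof.
  unfold Zbox. rewrite rsum_app, !rsum_map.
  pose proof (rsum_decay_nat N) as H.
  assert (H1 : rsum (fun n => decay (IZR (Z.of_nat n))) (seq 0 N) <= 3).
  { eapply Rle_trans; [|apply H]. apply rsum_le. intros n _.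
    rewrite <- INR_IZR_INZ; lra. }
  assert (H2 : rsum (fun n => decay (IZR (- Z.of_nat n))) (seq 0 N) <= 3).
  { eapply Rle_trans; [|apply H]. apply rsum_le. intros n _.
    rewrite opp_IZR, <- INR_IZR_INZ. unfold decay. rewrite Rabs_Ropp; lra. }
  lra.
Qed.

(** Up to sign this number is the area of the period parallelogram. If it vanished, [Cconj w2 * w1]
    would be real, and dividing it by [Cmod w2 ^ 2] gives [w1 / w2]. *)
Lemma Im_conj_mult_neq_0 (w1 w2 : C) :
  w2 <> 0%C -> ~ (exists r : R, (w1 / w2)%C = RtoC r) -> Im (Cconj w2 * w1) <> 0.
Proof.
  intros H2 Hr E. apply Hr. exists (Re (Cconj w2 * w1) / Cmod w2 ^ 2).
  assert (Hc : (Cconj w2 * w1)%C = RtoC (Re (Cconj w2 * w1))).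
  { apply injective_projections; [reflexivity | exact E]. }
  assert (Hm : Cmod w2 <> 0) by (intros H; apply H2, Cmod_eq_0, H).
  rewrite RtoC_div by (apply pow_nonzero, Hm). rewrite Cmod2_conj, <- Hc.
  assert (Hn : Cconj w2 <> 0%C).
  { intros H. apply Hm. rewrite <- Cmod_conj, H. apply Cmod_0. }
  field; auto.
Qed.

Lemma lattice_coordinates (w1 w2 : C) :
  w2 <> 0%C -> ~ (exists r : R, (w1 / w2)%C = RtoC r) ->
  exists (alpha beta : C -> R) (K : R), 0 < K /\
    (forall a b : R, alpha (a * w1 + b * w2)%C = a /\ beta (a * w1 + b * w2)%C = b) /\
    (forall w, Rabs (alpha w) <= K * Cmod w /\ Rabs (beta w) <= K * Cmod w).
Proof.
  intros H2 Hr. pose proof (Im_conj_mult_neq_0 w1 w2 H2 Hr) as HD.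
  set (D := Im (Cconj w2 * w1)) in *.
  assert (Himp : forall u v, Rabs (Im (Cconj u * v) / D) <= Cmod u / Rabs D * Cmod v).
  { intros u v. rewrite Rabs_div by assumption.
    apply Rabs_pos_lt in HD.
    replace (Cmod u / Rabs D * Cmod v) with (Cmod (Cconj u * v) / Rabs D)
      by (rewrite Cmod_mult, Cmod_conj; field; lra).
    apply Rmult_le_compat_r; [apply Rlt_le, Rinv_0_lt_compat, HD|].
    eapply Rle_trans; [apply Rmax_r | apply Rmax_Cmod]. }
  apply Rabs_pos_lt in HD as HD'.
  assert (Hd : forall u, 0 <= Cmod u / Rabs D).
  { intros u. apply Rmult_le_pos; [apply Cmod_ge_0 | apply Rlt_le, Rinv_0_lt_compat, HD']. }
  pose proof (Hd w1) as Hd1. pose proof (Hd w2) as Hd2.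
  (* Cramer's rule: pairing with [w2] kills the [w2] component, and pairing with [w1] kills the
     other. The bound follows from [|Im (Cconj u * w)| <= Cmod u * Cmod w]; the summand [1] in [K]
     only ensures positivity. *)
  exists (fun w => Im (Cconj w2 * w) / D), (fun w => - (Im (Cconj w1 * w) / D)).
  exists (Cmod w1 / Rabs D + Cmod w2 / Rabs D + 1). split; [lra|]. split.
  - intros a b. unfold D, Im in *. destruct w1, w2. simpl in *.
    split; field; lra.
  - intros w. rewrite Rabs_Ropp. pose proof (Cmod_ge_0 w).
    split; (eapply Rle_trans; [apply Himp|]); nra.
Qed.

Lemma lattice_inverse_cube_sum (w1 w2 : C) :
  w2 <> 0%C -> ~ (exists r : R, (w1 / w2)%C = RtoC r) ->
  exists M, forall S, finite_subset (lattice w1 w2) S ->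
    rsum (fun w => / (1 + Cmod w) ^ 3) S <= M.
Proof.
  intros H2 Hr.
  destruct (lattice_coordinates w1 w2 H2 Hr) as [alpha [beta [K [HK [Hco HKb]]]]].
  set (F := fun w => decay (alpha w) * decay (beta w)).
  (* [36] is the square of the one-dimensional bound [6]; [(1 + K) ^ 3] comes from [1 + |alpha w|]
     and [1 + |beta w|] both being at most [(1 + K) * (1 + Cmod w)]. *)
  exists ((1 + K) ^ 3 * 36). intros S [HSn HSL].
  assert (HF : forall w, / (1 + Cmod w) ^ 3 <= (1 + K) ^ 3 * F w).
  { intros w. destruct (HKb w) as [Ha Hb]. pose proof (Cmod_ge_0 w) as Hw.
    unfold F, decay. pose proof (Rabs_pos (alpha w)). pose proof (Rabs_pos (beta w)).
    set (A := 1 + Rabs (alpha w)) in *. set (B := 1 + Rabs (beta w)) in *.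
    set (m := Cmod w) in *. set (W := (1 + K) * (1 + m)).
    assert (HA : 0 < A <= W) by (unfold A, W; split; nra).
    assert (HB : 0 < B <= W) by (unfold B, W; split; nra).
    assert (sA : 0 < sqrt A) by (apply sqrt_lt_R0; lra).
    assert (sB : 0 < sqrt B) by (apply sqrt_lt_R0; lra).
    assert (sAW : sqrt A * sqrt B <= W).
    { rewrite <- (sqrt_sqrt W) by lra.
      apply Rmult_le_compat; try lra; apply sqrt_le_1; lra. }
    apply Rle_trans with ((1 + K) ^ 3 * / (W * W * W)).
    - right. unfold W; field; lra.
    - apply Rmult_le_compat_l; [apply pow_le; lra|].
      rewrite <- Rinv_mult. apply Rinv_le_contravar.
      + repeat apply Rmult_lt_0_compat; lra.
      + replace (A * sqrt A * (B * sqrt B)) with (A * B * (sqrt A * sqrt B)) by ring.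
        apply Rmult_le_compat; try nra. }
  assert (HF0 : forall w, 0 <= F w).
  { intros w; apply Rmult_le_pos; apply decay_ge_0. }
  eapply Rle_trans; [apply rsum_le; intros w _; apply HF|].
  rewrite rsum_scal. apply Rmult_le_compat_l; [apply pow_le; lra|].
  set (g := fun p : Z * Z => (IZR (fst p) * w1 + IZR (snd p) * w2)%C).
  (* A finite set of lattice points fits into a box of coefficients, where the double sum
     factors. *)
  assert (HN : exists N, incl S (map g (list_prod (Zbox N) (Zbox N)))).
  { clear HSn. induction S as [|w S IH].
    - exists 0%nat; intros w [].
    - destruct IH as [N HN]; [intros v Hv; apply HSL; now right|].
      destruct (HSL w (or_introl eq_refl)) as [a [b Hab]].
      exists (N + Z.to_nat (Z.abs a) + Z.to_nat (Z.abs b) + 1)%nat.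
      intros v [<-|Hv].
      + apply in_map_iff. exists (a, b). split; [now symmetry|].
        apply in_prod; apply in_Zbox; lia.
      + specialize (HN v Hv). apply in_map_iff in HN. destruct HN as [[c d] [Hcd Hin]].
        apply in_map_iff. exists (c, d). split; [assumption|].
        apply in_prod_iff in Hin. destruct Hin as [Hc Hd].
        assert (Hbox : forall x, In x (Zbox N) -> (Z.abs x < Z.of_nat N)%Z).
        { intros x Hx. apply in_app_or in Hx.
          destruct Hx as [Hx|Hx]; apply in_map_iff in Hx;
            destruct Hx as [n [<- Hn]]; apply in_seq in Hn; lia. }
        apply Hbox in Hc. apply Hbox in Hd.
        apply in_prod; apply in_Zbox; lia. }
  destruct HN as [N HN].
  eapply Rle_trans; [apply (rsum_incl F _ _ HF0 HSn HN)|].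
  rewrite rsum_map.
  eapply Rle_trans.
  - apply rsum_le with (G := fun p : Z * Z => decay (IZR (fst p)) * decay (IZR (snd p))).
    intros [a b] _. unfold F, g. simpl.
    destruct (Hco (IZR a) (IZR b)) as [-> ->]. lra.
  - rewrite (rsum_list_prod (fun a => decay (IZR a)) (fun b => decay (IZR b))).
    pose proof (rsum_decay_Zbox N).
    pose proof (rsum_ge_0 (fun a => decay (IZR a)) (Zbox N) (fun a => decay_ge_0 (IZR a))).
    nra.
Qed.

(** A nonzero lattice point has a nonzero integer coordinate, of absolute value at least [1] and at
    most [K * Cmod w]. *)
Lemma lattice_discrete (w1 w2 : C) :
  w2 <> 0%C -> ~ (exists r : R, (w1 / w2)%C = RtoC r) ->
  exists d, 0 < d /\ forall w, lattice w1 w2 w -> w <> 0%C -> d <= Cmod w.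
Proof.
  intros H2 Hr.
  destruct (lattice_coordinates w1 w2 H2 Hr) as [alpha [beta [K [HK [Hco HKb]]]]].
  exists (/ K). split; [now apply Rinv_0_lt_compat|].
  intros w [a [b ->]] Hw. destruct (Hco (IZR a) (IZR b)) as [Ha Hb].
  destruct (HKb (IZR a * w1 + IZR b * w2)%C) as [Ka Kb]. rewrite Ha in Ka. rewrite Hb in Kb.
  rewrite <- abs_IZR in Ka, Kb.
  assert (H1 : 1 <= K * Cmod (IZR a * w1 + IZR b * w2)).
  { destruct (Z.eq_dec a 0) as [->|Na].
    - destruct (Z.eq_dec b 0) as [->|Nb].
      + exfalso; apply Hw; ring.
      + eapply Rle_trans; [|apply Kb]. apply (IZR_le 1). lia.
    - eapply Rle_trans; [|apply Ka]. apply (IZR_le 1). lia. }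
  apply Rmult_le_reg_l with K; [assumption|]. rewrite Rinv_r; lra.
Qed.

(** A half period has a coordinate [1 / 2], which is no integer. Periodicity uses half periods as
    base points, so [wp] must be finite there. *)
Lemma half_periods_notin_lattice (w1 w2 : C) :
  w2 <> 0%C -> ~ (exists r : R, (w1 / w2)%C = RtoC r) ->
  ~ lattice w1 w2 (w1 / 2)%C /\ ~ lattice w1 w2 (w2 / 2)%C.
Proof.
  intros H2 Hr.
  destruct (lattice_coordinates w1 w2 H2 Hr) as [alpha [beta [K [_ [Hco _]]]]].
  assert (Hodd : forall a : Z, 1 / 2 <> IZR a).
  { intros a Ha. assert (IZR (2 * a) = 1) by (rewrite mult_IZR; lra).
    apply eq_IZR in H. lia. }
  split; intros [a [b Hab]].
  - apply (Hodd a). destruct (Hco (IZR a) (IZR b)) as [Ha _].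
    destruct (Hco (1 / 2) 0) as [Ha' _]. rewrite <- Ha, <- Hab, <- Ha'. f_equal.
    rewrite RtoC_div by lra. field.
  - apply (Hodd b). destruct (Hco (IZR a) (IZR b)) as [_ Hb].
    destruct (Hco 0 (1 / 2)) as [_ Hb']. rewrite <- Hb, <- Hab, <- Hb'. f_equal.
    rewrite RtoC_div by lra. field.
Qed.

(** * Termwise differentiation *)

(** Phrased as a uniform bound on finite sums, so that it passes at once to subsets of the
    lattice. *)
Definition inverse_cube_summable (D : C -> Prop) : Prop :=
  exists M, forall S, finite_subset D S -> rsum (fun w => / (1 + Cmod w) ^ 3) S <= M.

Lemma inverse_cube_summable_sub (D D' : C -> Prop) :
  (forall w, D w -> D' w) -> inverse_cube_summable D' -> inverse_cube_summable D.
Proof.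
  intros HD [M HM]. exists M. intros S [HSn HS]. apply HM. split; auto.
Qed.

Lemma rsum_inverse_cube_le (D : C -> Prop) f B M S :
  0 <= B -> (forall w, D w -> Cmod (f w) <= B * / (1 + Cmod w) ^ 3) ->
  (forall S, finite_subset D S -> rsum (fun w => / (1 + Cmod w) ^ 3) S <= M) ->
  finite_subset D S -> rsum (fun w => Cmod (f w)) S <= B * M.
Proof.
  intros HB Hf HM HS.
  eapply Rle_trans; [apply rsum_le; intros w Hw; apply Hf, HS, Hw|].
  rewrite rsum_scal. apply Rmult_le_compat_l; auto.
Qed.

(** The term of index [w] has its pole at [- w], so [z] keeps a positive distance from all the poles
    indexed by [D]. *)
Definition far (D : C -> Prop) (z : C) : Prop :=
  exists d, 0 < d /\ forall w, D w -> d <= Cmod (z + w).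

(** Upgrades the constant lower bound to one growing linearly in [w], as comparison with inverse
    cubes requires. Add [1 + Cmod z] times [d <= Cmod (z + w)] to [d] times
    [Cmod w - Cmod z <= Cmod (z + w)]. *)
Lemma far_bound D z :
  far D z -> exists c, 0 < c /\ forall w, D w -> c * (1 + Cmod w) <= Cmod (z + w).
Proof.
  intros [d [Hd H]]. pose proof (Cmod_ge_0 z) as Hz.
  exists (d / (1 + Cmod z + d)). split; [apply Rdiv_lt_0_compat; lra|].
  intros w Hw. specialize (H w Hw).
  assert (Hzw : Cmod w <= Cmod z + Cmod (z + w)).
  { replace w with (- z + (z + w))%C at 1 by ring.
    eapply Rle_trans; [apply Cmod_triangle|]. rewrite Cmod_opp; lra. }
  apply Rmult_le_reg_l with (1 + Cmod z + d); [lra|].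
  replace ((1 + Cmod z + d) * (d / (1 + Cmod z + d) * (1 + Cmod w)))
    with (d * (1 + Cmod w)) by (field; lra).
  nra.
Qed.

Lemma far_open D z :
  far D z -> exists d, 0 < d /\ forall y, Cmod (y - z) < d -> far D y.
Proof.
  intros [d [Hd H]]. exists (d / 2). split; [lra|]. intros y Hy.
  exists (d / 2). split; [lra|]. intros w Hw. specialize (H w Hw).
  replace (z + w)%C with (- (y - z) + (y + w))%C in H by ring.
  pose proof (Cmod_triangle (- (y - z)) (y + w)) as Ht. rewrite Cmod_opp in Ht. lra.
Qed.

Lemma Cmod_pos_neq_0 (x : C) t : 0 < t -> t <= Cmod x -> x <> 0%C.
Proof. intros Ht Hx ->. rewrite Cmod_0 in Hx; lra. Qed.

Lemma inv_sq_diff_bound (x y : C) t :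
  0 < t -> t <= Cmod x -> t <= Cmod y ->
  Cmod (1 / x ^ 2 - 1 / y ^ 2) <= 2 * Cmod (y - x) * / t ^ 3.
Proof.
  intros Ht Hx Hy.
  pose proof (Cmod_pos_neq_0 x t Ht Hx) as Nx. pose proof (Cmod_pos_neq_0 y t Ht Hy) as Ny.
  replace (1 / x ^ 2 - 1 / y ^ 2)%C with ((y - x) * (/ (x * y ^ 2) + / (x ^ 2 * y)))%C
    by (field; auto).
  rewrite Cmod_mult, (Rmult_comm 2), Rmult_assoc.
  apply Rmult_le_compat_l; [apply Cmod_ge_0|].
  eapply Rle_trans; [apply Cmod_triangle|].
  rewrite !Cmod_inv, !Cmod_mult, !Cmod_pow
    by (apply Cmult_neq_0; try apply Cpow_nz; assumption).
  assert (H1 : / (Cmod x * Cmod y ^ 2) <= / t ^ 3).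
  { apply Rinv_le_contravar; [apply pow_lt, Ht|].
    replace (t ^ 3) with (t * t ^ 2) by ring.
    apply Rmult_le_compat; try lra; [apply pow_le; lra | apply pow_incr; lra]. }
  assert (H2 : / (Cmod x ^ 2 * Cmod y) <= / t ^ 3).
  { apply Rinv_le_contravar; [apply pow_lt, Ht|].
    replace (t ^ 3) with (t ^ 2 * t) by ring.
    apply Rmult_le_compat; try lra; [apply pow_le; lra | apply pow_incr; lra]. }
  lra.
Qed.

Lemma inv_sq_taylor_bound (x h : C) :
  x <> 0%C -> Cmod h <= Cmod x / 2 ->
  Cmod (1 / (x + h) ^ 2 - 1 / x ^ 2 - h * (- 2 / x ^ 3)) <= 16 * Cmod h ^ 2 / Cmod x ^ 4.
Proof.
  intros Nx Hh. assert (Px : 0 < Cmod x) by (apply Cmod_gt_0; assumption).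
  assert (Hxh : Cmod x / 2 <= Cmod (x + h)).
  { pose proof (Cmod_triangle (x + h) (- h)) as Ht.
    replace (x + h + - h)%C with x in Ht by ring. rewrite Cmod_opp in Ht. lra. }
  assert (Nxh : (x + h)%C <> 0%C) by (apply Cmod_pos_neq_0 with (Cmod x / 2); lra).
  (* The exact remainder. Then [|3x + 2h| <= 4|x|] and [|x + h| >= |x| / 2] give the constant
     [4 * 4 = 16]. *)
  replace (1 / (x + h) ^ 2 - 1 / x ^ 2 - h * (- 2 / x ^ 3))%C
    with (h ^ 2 * (3 * x + 2 * h) / (x ^ 3 * (x + h) ^ 2))%C by (field; auto).
  rewrite Cmod_div by (apply Cmult_neq_0; apply Cpow_nz; assumption).
  rewrite !Cmod_mult, !Cmod_pow.
  assert (Hn : Cmod (3 * x + 2 * h) <= 4 * Cmod x).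
  { eapply Rle_trans; [apply Cmod_triangle|]. rewrite !Cmod_mult, !Cmod_R.
    rewrite !Rabs_pos_eq by lra. lra. }
  pose proof (pow_le (Cmod h) 2 (Cmod_ge_0 h)) as Hh2.
  apply Rle_trans with (Cmod h ^ 2 * (4 * Cmod x) * / (Cmod x ^ 3 * (Cmod x / 2) ^ 2)).
  - apply Rmult_le_compat.
    + apply Rmult_le_pos; [assumption | apply Cmod_ge_0].
    + apply Rlt_le, Rinv_0_lt_compat, Rmult_lt_0_compat; apply pow_lt; lra.
    + apply Rmult_le_compat_l; assumption.
    + apply Rinv_le_contravar; [apply Rmult_lt_0_compat; apply pow_lt; lra|].
      apply Rmult_le_compat_l; [apply pow_le; lra | apply pow_incr; lra].
  - right; field; lra.
Qed.

Lemma ex_usum_inv_sq_diff D z y :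
  inverse_cube_summable D -> far D z -> far D y ->
  ex_usum D (fun w => 1 / (z + w) ^ 2 - 1 / (y + w) ^ 2)%C.
Proof.
  intros [M HM] Hz Hy.
  destruct (far_bound D z Hz) as [a [Ha HzD]]. destruct (far_bound D y Hy) as [b [Hb HyD]].
  set (c := Rmin a b). assert (Hc : 0 < c) by (apply Rmin_glb_lt; assumption).
  assert (HB : 0 <= 2 * Cmod (y - z) * / c ^ 3).
  { apply Rmult_le_pos; [pose proof (Cmod_ge_0 (y - z)); lra|].
    apply Rlt_le, Rinv_0_lt_compat, pow_lt, Hc. }
  apply (ex_usum_abs _ _ (2 * Cmod (y - z) * / c ^ 3 * M)). intros S HS.
  apply (rsum_inverse_cube_le D); auto. intros w Hw.
  specialize (HzD w Hw). specialize (HyD w Hw).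
  pose proof (Cmod_ge_0 w) as Hw0.
  assert (Hca : c <= a) by apply Rmin_l. assert (Hcb : c <= b) by apply Rmin_r.
  eapply Rle_trans; [apply (inv_sq_diff_bound _ _ (c * (1 + Cmod w))); nra|].
  right. replace (y + w - (z + w))%C with (y - z)%C by ring. field. lra.
Qed.

(** Away from the index [0], [wp_term z w] is the difference of inverse squares at [z] and at
    [y = 0]. If [0] belongs to [D], that single term is put back afterwards. *)
Lemma ex_usum_wp_term (D : C -> Prop) z :
  inverse_cube_summable D -> far (fun w => D w /\ w <> 0%C) 0%C -> far D z ->
  ex_usum D (wp_term z).
Proof.
  intros HD H0 Hz. set (D0 := fun w => D w /\ w <> 0%C) in H0.
  assert (HD0 : inverse_cube_summable D0)
    by (apply (inverse_cube_summable_sub _ D); [intros w []; assumption | assumption]).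
  assert (Hz0 : far D0 z).
  { destruct Hz as [d [Hd H]]. exists d; split; [assumption|]. intros w [Hw _]; auto. }
  destruct (ex_usum_inv_sq_diff D0 z 0 HD0 Hz0 H0) as [l Hl].
  assert (Hl' : is_usum D0 (wp_term z) l).
  { apply is_usum_ext with (2 := Hl). intros w _. unfold wp_term.
    now replace (0 + w)%C with w by ring. }
  destruct (classic (D 0%C)) as [HD00|HD00].
  - exists (wp_term z 0 + l)%C. apply is_usum_insert with (3 := Hl').
    + intros [_ H]; auto.
    + intros w. unfold D0. destruct (classic (w = 0%C)) as [->|]; tauto.
  - exists l. revert Hl'. rewrite !is_usumE. intros Hl' eps Heps.
    assert (E : forall S, finite_subset D S <-> finite_subset D0 S).
    { intros S. split; intros [HSn HS]; (split; [assumption|]); intros w Hw.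
      - split; [auto|]. intros ->. auto.
      - apply HS, Hw. }
    destruct (Hl' eps Heps) as [S0 [HS0 HS]]. exists S0.
    split; [now apply E|]. intros S HSD. apply HS. now apply E.
Qed.

Lemma is_derive_quadratic_error (g : C -> C) (z l : C) d B :
  0 < d ->
  (forall h, Cmod h < d -> Cmod (g (z + h)%C - g z - h * l) <= B * Cmod h ^ 2) ->
  is_derive (V := C_NormedModule) g z l.
Proof.
  intros Hd H. split; [apply is_linear_scal_l|]. intros x Hx.
  rewrite <- (is_filter_lim_locally_unique _ _ Hx). clear x Hx. intros eps.
  pose proof (cond_pos eps) as He. pose proof (Rabs_pos B) as HB.
  (* The second bound turns the error [B * |h| ^ 2] into at most [eps * |h|]; [Rabs B + 1] is
     positive whatever the sign of [B]. *)
  assert (Hd' : 0 < Rmin d (eps / (Rabs B + 1))).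
  { apply Rmin_glb_lt; [assumption | apply Rdiv_lt_0_compat; lra]. }
  exists (mkposreal _ Hd'). intros y Hy.
  change (Cmod (y - z) < Rmin d (eps / (Rabs B + 1))) in Hy.
  change (Cmod (g y - g z - (y - z) * l) <= eps * Cmod (y - z)).
  pose proof (Rlt_le_trans _ _ _ Hy (Rmin_l _ _)) as Hy1.
  pose proof (Rlt_le_trans _ _ _ Hy (Rmin_r _ _)) as Hy2.
  apply Rlt_div_r in Hy2; [|lra].
  specialize (H (y - z)%C Hy1).
  assert (E : forall a b : C, (a + (b - a))%C = b) by (intros; ring).
  rewrite E in H.
  eapply Rle_trans; [apply H|].
  pose proof (Cmod_ge_0 (y - z)). pose proof (Rle_abs B).
  replace (Cmod (y - z) ^ 2) with (Cmod (y - z) * Cmod (y - z)) by ring.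
  rewrite <- Rmult_assoc. apply Rmult_le_compat_r; [assumption|]. nra.
Qed.

(* The second-order Taylor remainders of the terms are themselves summable, with
   sum O(h^2), so no interchange of limits is needed. *)
Lemma ex_derive_usum_wp_term (D : C -> Prop) z :
  inverse_cube_summable D -> far (fun w => D w /\ w <> 0%C) 0%C -> far D z ->
  ex_derive (V := C_NormedModule) (fun y => usum D (wp_term y)) z.
Proof.
  intros HD H0 Hz.
  destruct (far_open D z Hz) as [r [Hr Hfar]].
  destruct (far_bound D z Hz) as [c [Hc HcD]].
  destruct Hz as [d [Hd HdD]].
  destruct HD as [M HM]. assert (HD : inverse_cube_summable D) by (exists M; exact HM).
  assert (Pc : 0 < / c ^ 3) by apply Rinv_0_lt_compat, pow_lt, Hc.
  assert (Hcube : forall w, D w -> / Cmod (z + w) ^ 3 <= / c ^ 3 * / (1 + Cmod w) ^ 3).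
  { intros w Hw. pose proof (Cmod_ge_0 w). rewrite <- Rinv_mult, <- Rpow_mult_distr.
    apply Rinv_le_contravar; [apply pow_lt; nra|].
    apply pow_incr. specialize (HcD w Hw). nra. }
  assert (Nzw : forall w, D w -> (z + w)%C <> 0%C)
    by (intros w Hw; apply Cmod_pos_neq_0 with d; auto).
  assert (Hder : ex_usum D (fun w => - 2 / (z + w) ^ 3)%C).
  { apply (ex_usum_abs _ _ (2 * / c ^ 3 * M)). intros S HS.
    apply (rsum_inverse_cube_le D); auto; [lra|]. intros w Hw.
    rewrite Cmod_div by (apply Cpow_nz; auto).
    rewrite Cmod_pow, Cmod_R, Rabs_left, Rmult_assoc by lra.
    replace (- -2) with 2 by ring. apply Rmult_le_compat_l; [lra | auto]. }
  exists (usum D (fun w => - 2 / (z + w) ^ 3)%C).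
  assert (HB : 0 < 16 / (d * c ^ 3))
    by (apply Rdiv_lt_0_compat; [lra|]; apply Rmult_lt_0_compat; [lra | apply pow_lt, Hc]).
  (* Within [r] the sum at [z + h] still converges; within [d / 2] the Taylor bound applies to every
     term. Of the four factors in its denominator [|z + w| ^ 4], one is bounded below by [d], the
     other three by [c * (1 + Cmod w)]. *)
  apply is_derive_quadratic_error with (d := Rmin r (d / 2)) (B := 16 / (d * c ^ 3) * M).
  { apply Rmin_glb_lt; lra. }
  intros h Hh.
  pose proof (Rlt_le_trans _ _ _ Hh (Rmin_l _ _)) as Hh1.
  pose proof (Rlt_le_trans _ _ _ Hh (Rmin_r _ _)) as Hh2.
  assert (Hzh : far D (z + h)%C)
    by (apply Hfar; now replace (z + h - z)%C with h by ring).
  assert (Hz : far D z) by (exists d; auto).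
  pose proof (is_usum_minus _ _ _ _ _
    (is_usum_minus _ _ _ _ _ (usum_correct _ _ (ex_usum_wp_term D _ HD H0 Hzh))
                             (usum_correct _ _ (ex_usum_wp_term D _ HD H0 Hz)))
    (is_usum_scal _ h _ _ (usum_correct _ _ Hder))) as Hsum.
  replace (16 / (d * c ^ 3) * M * Cmod h ^ 2)
    with (16 / (d * c ^ 3) * Cmod h ^ 2 * M) by ring.
  apply (is_usum_bound _ _ _ _ Hsum). intros S HS.
  eapply Rle_trans; [apply Cmod_finite_sum|].
  pose proof (pow_le (Cmod h) 2 (Cmod_ge_0 h)) as Hhsq.
  apply (rsum_inverse_cube_le D); auto; [apply Rmult_le_pos; lra|].
  intros w Hw. specialize (HdD w Hw). specialize (Hcube w Hw).
  replace (wp_term (z + h)%C w - wp_term z w - h * (- 2 / (z + w) ^ 3))%C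
    with (1 / (z + w + h) ^ 2 - 1 / (z + w) ^ 2 - h * (- 2 / (z + w) ^ 3))%C
    by (unfold wp_term; replace (z + h + w)%C with (z + w + h)%C by ring; ring).
  eapply Rle_trans; [apply inv_sq_taylor_bound; [auto | lra]|].
  set (x := Cmod (z + w)) in *.
  apply Rle_trans with (16 * Cmod h ^ 2 / d * / x ^ 3).
  - replace (16 * Cmod h ^ 2 / x ^ 4) with (16 * Cmod h ^ 2 * / x ^ 3 * / x)
      by (field; lra).
    replace (16 * Cmod h ^ 2 / d * / x ^ 3) with (16 * Cmod h ^ 2 * / x ^ 3 * / d)
      by (field; lra).
    apply Rmult_le_compat_l; [|apply Rinv_le_contravar; lra].
    apply Rmult_le_pos; [lra|]. apply Rlt_le, Rinv_0_lt_compat, pow_lt; lra.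
  - replace (16 / (d * c ^ 3) * Cmod h ^ 2 * / (1 + Cmod w) ^ 3)
      with (16 * Cmod h ^ 2 / d * (/ c ^ 3 * / (1 + Cmod w) ^ 3)).
    + apply Rmult_le_compat_l; [|assumption].
      apply Rmult_le_pos; [lra | apply Rlt_le, Rinv_0_lt_compat, Hd].
    + pose proof (Cmod_ge_0 w). field. repeat split; lra.
Qed.

(** * The Weierstrass function *)

Lemma lattice_0 (w1 w2 : C) : lattice w1 w2 0%C.
Proof. exists 0%Z, 0%Z. ring. Qed.

Lemma lattice_add (w1 w2 u v : C) :
  lattice w1 w2 u -> lattice w1 w2 v -> lattice w1 w2 (u + v)%C.
Proof.
  intros [a [b ->]] [c [d ->]]. exists (a + c)%Z, (b + d)%Z.
  rewrite !plus_IZR, !RtoC_plus. ring.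
Qed.

Lemma lattice_opp (w1 w2 u : C) : lattice w1 w2 u -> lattice w1 w2 (- u)%C.
Proof.
  intros [a [b ->]]. exists (- a)%Z, (- b)%Z. rewrite !opp_IZR, !RtoC_opp. ring.
Qed.

Lemma lattice_opp_iff (w1 w2 u : C) : lattice w1 w2 u <-> lattice w1 w2 (- u)%C.
Proof.
  split; [apply lattice_opp|]. intros H. apply lattice_opp in H.
  now replace (- - u)%C with u in H by ring.
Qed.

Lemma lattice_add_iff (w1 w2 u v : C) :
  lattice w1 w2 v -> lattice w1 w2 u <-> lattice w1 w2 (u + v)%C.
Proof.
  intros Hv. split; [intros Hu; now apply lattice_add|]. intros H.
  replace u with (u + v + - v)%C by ring.
  apply lattice_add; [assumption | now apply lattice_opp].
Qed.

Lemma lattice_l (w1 w2 : C) : lattice w1 w2 w1.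
Proof. exists 1%Z, 0%Z. ring. Qed.

Lemma lattice_r (w1 w2 : C) : lattice w1 w2 w2.
Proof. exists 0%Z, 1%Z. ring. Qed.

(** Distinct lattice points are at least [d] apart, so at most one [w] has [0 < |z + w| < d / 2]. If
    there is one, its distance is the minimum; otherwise [d / 2] works. *)
Lemma lattice_far (w1 w2 z : C) :
  w2 <> 0%C -> ~ (exists r : R, (w1 / w2)%C = RtoC r) ->
  far (fun w => lattice w1 w2 w /\ (z + w)%C <> 0%C) z.
Proof.
  intros H2 Hr. destruct (lattice_discrete w1 w2 H2 Hr) as [d [Hd Hsep]].
  destruct (classic (exists w0, lattice w1 w2 w0 /\ (z + w0)%C <> 0%C /\ Cmod (z + w0) < d / 2))
    as [[w0 [HL0 [Hn0 Hlt]]]|Hno].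
  - exists (Cmod (z + w0)). split; [now apply Cmod_gt_0|]. intros w [HL Hn].
    apply Rnot_lt_le. intros Hw.
    assert (Hww : Cmod (w + - w0) < d).
    { replace (w + - w0)%C with ((z + w) + - (z + w0))%C by ring.
      eapply Rle_lt_trans; [apply Cmod_triangle|]. rewrite Cmod_opp. lra. }
    destruct (classic ((w + - w0)%C = 0%C)) as [E|E].
    + replace w with (w + - w0 + w0)%C in Hw by ring. rewrite E in Hw.
      replace (z + (0 + w0))%C with (z + w0)%C in Hw by ring. lra.
    + assert (d <= Cmod (w + - w0)); [|lra].
      apply Hsep; [apply lattice_add; [|apply lattice_opp]|]; assumption.
  - exists (d / 2). split; [lra|]. intros w [HL Hn].
    apply Rnot_lt_le. intros Hw. apply Hno. eauto.
Qed.

Lemma far_sub (D D' : C -> Prop) z : (forall w, D w -> D' w) -> far D' z -> far D z.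
Proof. intros HD [d [Hd H]]. exists d. auto. Qed.

Lemma not_lattice_far (w1 w2 z : C) :
  w2 <> 0%C -> ~ (exists r : R, (w1 / w2)%C = RtoC r) ->
  ~ lattice w1 w2 z -> far (lattice w1 w2) z.
Proof.
  intros H2 Hr Hz. eapply far_sub; [|apply (lattice_far w1 w2 z H2 Hr)].
  intros w Hw. split; [assumption|]. intros E. apply Hz.
  replace z with (- w)%C; [now apply lattice_opp|].
  replace (- w)%C with (z - (z + w))%C by ring. rewrite E. ring.
Qed.

Lemma far_0_lattice (w1 w2 : C) (D : C -> Prop) :
  w2 <> 0%C -> ~ (exists r : R, (w1 / w2)%C = RtoC r) ->
  (forall w, D w -> lattice w1 w2 w) -> far (fun w => D w /\ w <> 0%C) 0%C.
Proof.
  intros H2 Hr HD. eapply far_sub; [|apply (lattice_far w1 w2 0 H2 Hr)].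
  intros w [Hw Hn]. split; [auto|]. now replace (0 + w)%C with w by ring.
Qed.

Lemma ex_usum_wp_term_lattice (w1 w2 z : C) (D : C -> Prop) :
  w2 <> 0%C -> ~ (exists r : R, (w1 / w2)%C = RtoC r) ->
  (forall w, D w -> lattice w1 w2 w) -> far D z -> ex_usum D (wp_term z).
Proof.
  intros H2 Hr HD Hz. apply ex_usum_wp_term; [| |assumption].
  - apply (inverse_cube_summable_sub _ _ HD). exact (lattice_inverse_cube_sum w1 w2 H2 Hr).
  - now apply (far_0_lattice w1 w2).
Qed.

Lemma holomorphic_near_usum_wp_term (w1 w2 z : C) (D : C -> Prop) :
  w2 <> 0%C -> ~ (exists r : R, (w1 / w2)%C = RtoC r) ->
  (forall w, D w -> lattice w1 w2 w) -> far D z ->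
  holomorphic_near (fun y => usum D (wp_term y)) z.
Proof.
  intros H2 Hr HD Hz. apply locally_Cmod.
  destruct (far_open D z Hz) as [d [Hd Hy]]. exists d. split; [assumption|].
  intros y Hyz. apply ex_derive_usum_wp_term; [| |auto].
  - apply (inverse_cube_summable_sub _ _ HD). exact (lattice_inverse_cube_sum w1 w2 H2 Hr).
  - now apply (far_0_lattice w1 w2).
Qed.

(* Coquelicot's [/ 0 = 0] makes the term of index [0] equal to [1 / z ^ 2]. *)
Lemma wp_term_0_r z : wp_term z 0 = (1 / z ^ 2)%C.
Proof.
  unfold wp_term. replace (z + 0)%C with z by ring.
  replace (1 / 0 ^ 2)%C with (RtoC 0); [ring|].
  unfold Cdiv. replace (0 ^ 2)%C with (RtoC 0) by ring.
  unfold Cinv, Cmult, RtoC. simpl. unfold Rdiv. f_equal; ring.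
Qed.

(** Absorbing [1 / z ^ 2] as the term of index [0] makes the index set the full lattice, which
    negation and translation by periods preserve. *)
Lemma wp_finite (w1 w2 z : C) :
  w2 <> 0%C -> ~ (exists r : R, (w1 / w2)%C = RtoC r) -> ~ lattice w1 w2 z ->
  wp w1 w2 z = finite (usum (lattice w1 w2) (wp_term z)).
Proof.
  intros H2 Hr Hz. unfold wp. destruct excluded_middle_informative; [contradiction|].
  f_equal. symmetry. apply usum_unique. rewrite <- wp_term_0_r.
  apply is_usum_insert with (D := lattice_nonzero w1 w2).
  - intros [_ H]; auto.
  - intros w. unfold lattice_nonzero. pose proof (lattice_0 w1 w2).
    destruct (classic (w = 0%C)) as [->|]; tauto.
  - apply usum_correct, (ex_usum_wp_term_lattice w1 w2); auto; [intros w []; auto|].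
    apply (far_sub _ (lattice w1 w2)); [intros w []; auto | now apply not_lattice_far].
Qed.

Lemma wp_infty (w1 w2 z : C) : lattice w1 w2 z -> wp w1 w2 z = infty.
Proof. intros Hz. unfold wp. now destruct excluded_middle_informative. Qed.

Lemma holomorphic_at_wp (w1 w2 z : C) :
  w2 <> 0%C -> ~ (exists r : R, (w1 / w2)%C = RtoC r) -> ~ lattice w1 w2 z ->
  holomorphic_at (wp w1 w2) z.
Proof.
  intros H2 Hr Hz. pose proof (not_lattice_far w1 w2 z H2 Hr Hz) as Hf.
  exists (fun y => usum (lattice w1 w2) (wp_term y)). split.
  - apply (holomorphic_near_usum_wp_term w1 w2); auto.
  - apply locally_Cmod. destruct (far_open _ _ Hf) as [d [Hd Hy]].
    exists d. split; [assumption|]. intros y Hyz. apply wp_finite; auto.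
    (* A lattice point [y] has [- y] as an index, at distance [0], so it is never [far] from the
       lattice. *)
    intros HL. destruct (Hy y Hyz) as [e [He H]].
    specialize (H _ (lattice_opp _ _ _ HL)).
    replace (y + - y)%C with (RtoC 0) in H by ring. rewrite Cmod_0 in H. lra.
Qed.

(** * Poles *)

Lemma finite_inj a b : finite a = finite b -> a = b.
Proof. unfold finite. congruence. Qed.

(** Otherwise [g y = G y * (y - z) ^ n] on a punctured neighbourhood, with [G] bounded near [z] and
    [n >= 1]; so [g] would tend to [0], against continuity and [g z <> 0]. *)
Lemma holomorphic_at_not_pole (f : C -> sphere) z : holomorphic_at f z -> ~ pole f z.
Proof.
  intros [G [HG HfG]] [n [Hn [g [Hg [Hgz Hfg]]]]].
  assert (Hcont : forall k : C -> C, holomorphic_near k z -> forall eps, 0 < eps ->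
            locally (T := C_UniformSpace) z (fun y => Cmod (k y - k z) < eps)).
  { intros k Hk eps Heps. apply locally_singleton in Hk.
    apply ex_derive_continuous in Hk.
    assert (HP : locally (T := C_UniformSpace) (k z) (fun u => Cmod (u - k z) < eps)).
    { apply locally_Cmod. exists eps; auto. }
    specialize (Hk _ HP). apply locally_C. exact Hk. }
  assert (Pg : 0 < Cmod (g z) / 2) by (apply Cmod_gt_0 in Hgz; lra).
  pose proof (Hcont g Hg _ Pg) as Cg. pose proof (Hcont G HG 1 Rlt_0_1) as CG.
  unfold locally', within in Hfg.
  pose proof (filter_and _ _ HfG (filter_and _ _ Hfg (filter_and _ _ Cg CG))) as H.
  apply locally_Cmod in H. destruct H as [d [Hd H]].
  pose proof (Cmod_ge_0 (G z)) as HGz.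
  set (e := Cmod (g z) / 2) in *.
  (* One test point [z + t] suffices: [t < d] keeps it in the neighbourhood, [t <= 1] gives
     [t ^ n <= t], and the last bound gives [|g (z + t)| <= e / 2], whereas [|g z| = 2 * e] forces
     [|g (z + t)| >= e]. *)
  set (t := Rmin (d / 2) (Rmin 1 (e / (2 * (Cmod (G z) + 1))))).
  assert (Ht : 0 < t).
  { unfold t. repeat apply Rmin_glb_lt; try lra. apply Rdiv_lt_0_compat; lra. }
  assert (Htd : t <= d / 2) by apply Rmin_l.
  assert (Ht1 : t <= 1) by (eapply Rle_trans; [apply Rmin_r | apply Rmin_l]).
  assert (Hte : t <= e / (2 * (Cmod (G z) + 1)))
    by (eapply Rle_trans; [apply Rmin_r | apply Rmin_r]).
  apply Rle_div_r in Hte; [|lra].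
  assert (Ez : (z + t - z)%C = RtoC t) by ring.
  assert (Nt : RtoC t <> 0%C).
  { intros E. apply (f_equal Cmod) in E. rewrite Cmod_0, Cmod_R, Rabs_pos_eq in E; lra. }
  destruct (H (z + t)%C) as [H1 [H2 [H3 H4]]].
  { rewrite Ez, Cmod_R, Rabs_pos_eq; lra. }
  rewrite H2, Ez in H1; [|intros E; apply Nt; rewrite <- Ez, E; ring].
  apply finite_inj in H1.
  assert (E : g (z + t)%C = (G (z + t)%C * t ^ n)%C)
    by (rewrite <- H1; field; apply Cpow_nz, Nt).
  assert (U : Cmod (g (z + t)%C) <= (Cmod (G z) + 1) * t).
  { rewrite E, Cmod_mult, Cmod_pow, Cmod_R, Rabs_pos_eq by lra.
    apply Rmult_le_compat; [apply Cmod_ge_0 | apply pow_le; lra | |].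
    - replace (G (z + t)%C) with (G (z + t)%C - G z + G z)%C by ring.
      eapply Rle_trans; [apply Cmod_triangle|]. lra.
    - destruct n as [|n]; [lia|]. simpl.
      assert (t ^ n <= 1) by (rewrite <- (pow1 n); apply pow_incr; lra). nra. }
  assert (Lo : Cmod (g z) <= Cmod (g (z + t)%C) + e).
  { replace (g z) with (g (z + t)%C + - (g (z + t)%C - g z))%C by ring.
    eapply Rle_trans; [apply Cmod_triangle|]. rewrite Cmod_opp. lra. }
  unfold e in *. nra.
Qed.

(* The two normed modules carry the same norm but distinct uniform structures. *)
Lemma is_derive_C_AbsRing (f : C -> C) z l :
  is_derive (V := C_NormedModule) f z l <->
  is_derive (V := AbsRing_NormedModule C_AbsRing) f z l.
Proof.
  split; intros [_ H]; (split; [apply is_linear_scal_l | exact H]).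
Qed.

Lemma ex_derive_Cmult (f g : C -> C) z :
  ex_derive (V := C_NormedModule) f z -> ex_derive (V := C_NormedModule) g z ->
  ex_derive (V := C_NormedModule) (fun y => f y * g y)%C z.
Proof.
  intros [df Hf%is_derive_C_AbsRing] [dg Hg%is_derive_C_AbsRing].
  eexists. apply is_derive_C_AbsRing.
  apply (is_derive_mult (K := C_AbsRing) f g z df dg Hf Hg). exact Cmult_comm.
Qed.

Lemma pole_wp (w1 w2 p : C) :
  w2 <> 0%C -> ~ (exists r : R, (w1 / w2)%C = RtoC r) -> lattice w1 w2 p ->
  pole_of_order 2 (wp w1 w2) p.
Proof.
  intros H2 Hr Hp. split; [lia|].
  set (D := fun w => lattice w1 w2 w /\ (p + w)%C <> 0%C).
  assert (Hf : far D p) by now apply lattice_far.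
  assert (HD : forall w, D w -> lattice w1 w2 w) by (intros w []; assumption).
  set (H := fun y => usum D (wp_term y)).
  (* This is [(y - p) ^ 2] times the whole sum: the omitted index [- p] contributes
     [1 / (y - p) ^ 2 - 1 / (- p) ^ 2], the others [H y]. Its value at [p] is [1]. *)
  exists (fun y => 1 + (y - p) * (y - p) * (H y - 1 / (- p) ^ 2))%C.
  repeat split.
  - pose proof (holomorphic_near_usum_wp_term w1 w2 p D H2 Hr HD Hf) as Hh.
    unfold holomorphic_near in *. revert Hh. apply filter_imp. intros y Hy.
    assert (Hid : ex_derive (V := C_NormedModule) (fun y : C => y - p)%C y).
    { apply (ex_derive_minus (V := C_NormedModule) (fun y : C => y) (fun _ => p)).
      - exists (RtoC 1). apply is_derive_C_AbsRing. exact (is_derive_id (K := C_AbsRing) y).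
      - apply ex_derive_const. }
    apply (ex_derive_plus (V := C_NormedModule) (fun _ => RtoC 1)); [apply ex_derive_const|].
    apply ex_derive_Cmult; [now apply ex_derive_Cmult|].
    apply (ex_derive_minus (V := C_NormedModule) H (fun _ => (1 / (- p) ^ 2)%C));
      [assumption | apply ex_derive_const].
  - intros E. apply (f_equal Cmod) in E.
    replace (1 + (p - p) * (p - p) * (H p - 1 / (- p) ^ 2))%C with (RtoC 1) in E by ring.
    rewrite Cmod_0, Cmod_1 in E. lra.
  - unfold locally', within. apply locally_Cmod.
    destruct (far_open D p Hf) as [d [Hd Hfar]]. exists d; split; [assumption|].
    intros y Hy Hyp. specialize (Hfar y Hy).
    assert (Nyp : (y - p)%C <> 0%C).
    { intros E. apply Hyp. now apply Ceq_minus. }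
    (* Near [p] there is no other lattice point: if [y] were one, [- y] would lie in [D] at distance
       [0] from [y]. *)
    assert (Hny : ~ lattice w1 w2 y).
    { intros HL. destruct Hfar as [e [He Hfar]].
      assert (HDy : D (- y)%C).
      { split; [now apply lattice_opp|]. intros E. apply Nyp.
        replace (y - p)%C with (- (p + - y))%C by ring. rewrite E. ring. }
      specialize (Hfar _ HDy). replace (y + - y)%C with (RtoC 0) in Hfar by ring.
      rewrite Cmod_0 in Hfar. lra. }
    rewrite wp_finite by assumption. f_equal. apply usum_unique.
    replace ((1 + (y - p) * (y - p) * (H y - 1 / (- p) ^ 2)) / (y - p) ^ 2)%C
      with (wp_term y (- p) + H y)%C.
    + apply is_usum_insert with (D := D).
      * intros [_ E]. apply E. ring.
      * intros w. unfold D. split.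
        -- intros Hw. destruct (classic ((p + w)%C = 0%C)) as [E|]; [left|tauto].
           replace w with (p + w - p)%C by ring. rewrite E. ring.
        -- intros [->|[]]; [now apply lattice_opp | assumption].
      * apply usum_correct, (ex_usum_wp_term_lattice w1 w2); assumption.
    + unfold wp_term. replace (y + - p)%C with (y - p)%C by ring.
      (* Abstracting the constant keeps [field] from asking for [p <> 0]; at [p = 0] the identity
         holds with whatever value [k] has. *)
      set (k := (1 / (- p) ^ 2)%C). field. assumption.
Qed.

(** * Evenness and periodicity *)

Lemma wp_even (w1 w2 z : C) :
  w2 <> 0%C -> ~ (exists r : R, (w1 / w2)%C = RtoC r) ->
  wp w1 w2 (- z)%C = wp w1 w2 z.
Proof.
  intros H2 Hr. destruct (classic (lattice w1 w2 z)) as [Hz|Hz].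
  - rewrite !wp_infty; auto. now apply lattice_opp.
  - assert (Hz' : ~ lattice w1 w2 (- z)%C) by (intros H; apply Hz; now apply lattice_opp_iff).
    rewrite !wp_finite by assumption. f_equal. apply usum_unique.
    apply is_usum_ext with (f := fun w => wp_term z (- w)%C).
    { intros w _. unfold wp_term.
      replace ((z + - w) ^ 2)%C with ((- z + w) ^ 2)%C by ring.
      now replace ((- w) ^ 2)%C with (w ^ 2)%C by ring. }
    apply is_usum_reindex with (D' := lattice w1 w2) (psi := Copp) (phi := Copp);
      try (intros; ring); [intros; apply lattice_opp_iff|].
    apply usum_correct, (ex_usum_wp_term_lattice w1 w2); auto.
    now apply not_lattice_far.
Qed.

(* The difference of two values of [wp] is a sum over the whole lattice of
   [1 / (z + w) ^ 2 - 1 / (y + w) ^ 2], which shifting the index leaves unchanged. *)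
Lemma usum_wp_term_diff_translate (w1 w2 z y v : C) :
  w2 <> 0%C -> ~ (exists r : R, (w1 / w2)%C = RtoC r) ->
  lattice w1 w2 v -> ~ lattice w1 w2 z -> ~ lattice w1 w2 y ->
  (usum (lattice w1 w2) (wp_term (z + v)) - usum (lattice w1 w2) (wp_term (y + v)) =
   usum (lattice w1 w2) (wp_term z) - usum (lattice w1 w2) (wp_term y))%C.
Proof.
  intros H2 Hr Hv Hz Hy.
  assert (Hex : forall x, ~ lattice w1 w2 x ->
            is_usum (lattice w1 w2) (wp_term x) (usum (lattice w1 w2) (wp_term x))).
  { intros x Hx. apply usum_correct, (ex_usum_wp_term_lattice w1 w2); auto.
    now apply not_lattice_far. }
  assert (Hzv : ~ lattice w1 w2 (z + v)%C) by (rewrite <- lattice_add_iff; assumption).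
  assert (Hyv : ~ lattice w1 w2 (y + v)%C) by (rewrite <- lattice_add_iff; assumption).
  pose proof (is_usum_minus _ _ _ _ _ (Hex _ Hzv) (Hex _ Hyv)) as Hsum.
  eapply is_usum_unique; [exact Hsum|].
  (* The shift changes the subtracted [1 / w ^ 2] into [1 / (w + v) ^ 2], but these constants cancel
     in the difference. *)
  apply is_usum_ext with (f := fun w => (wp_term z (w + v) - wp_term y (w + v))%C).
  { intros w _. unfold wp_term.
    replace (z + v + w)%C with (z + (w + v))%C by ring.
    replace (y + v + w)%C with (y + (w + v))%C by ring. ring. }
  apply (is_usum_reindex (lattice w1 w2) (lattice w1 w2)
           (fun w => w + v)%C (fun w => w - v)%C
           (fun w => wp_term z w - wp_term y w)%C); try (intros; ring).
  - intros w. now apply lattice_add_iff.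
  - now apply is_usum_minus; apply Hex.
Qed.

Lemma wp_periodic (w1 w2 z v : C) :
  w2 <> 0%C -> ~ (exists r : R, (w1 / w2)%C = RtoC r) ->
  lattice w1 w2 v -> ~ lattice w1 w2 (v / 2)%C ->
  wp w1 w2 (z + v)%C = wp w1 w2 z.
Proof.
  intros H2 Hr Hv Hv2. destruct (classic (lattice w1 w2 z)) as [Hz|Hz].
  - rewrite !wp_infty; auto. now apply lattice_add.
  - assert (Hv2' : ~ lattice w1 w2 (- (v / 2))%C)
      by (intros H; apply Hv2; now apply lattice_opp_iff).
    pose proof (usum_wp_term_diff_translate w1 w2 z (- (v / 2))%C v H2 Hr Hv Hz Hv2') as H.
    replace (- (v / 2) + v)%C with (v / 2)%C in H by field.
    pose proof (wp_even w1 w2 (v / 2)%C H2 Hr) as He.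
    (* Evenness makes the sums at [v / 2] and [- (v / 2)] equal, so they cancel from the two sides
       of [H]. *)
    rewrite !wp_finite in He by assumption. apply finite_inj in He. rewrite He in H.
    rewrite !wp_finite; auto.
    + f_equal. set (a := usum _ (wp_term (v / 2))) in *.
      replace (usum (lattice w1 w2) (wp_term (z + v)))
        with (usum (lattice w1 w2) (wp_term (z + v)) - a + a)%C by ring.
      rewrite H. ring.
    + intros HL. apply Hz. now apply (lattice_add_iff w1 w2 z v).
Qed.

Theorem theorem3p1 (w1 w2 : C) (hw1 : w1 <> 0%C) (hw2 : w2 <> 0%C)
    (hw : ~ exists r : R, (w1 / w2)%C = RtoC r) :
  (forall z : C, ~ lattice w1 w2 z ->
     ex_usum (lattice_nonzero w1 w2) (wp_term z)) /\
  elliptic w1 w2 (wp w1 w2) /\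
  (forall w : C, lattice w1 w2 w -> pole_of_order 2 (wp w1 w2) w) /\
  (forall z : C, ~ lattice w1 w2 z -> ~ pole (wp w1 w2) z) /\
  (forall z : C, wp w1 w2 (- z)%C = wp w1 w2 z).
Proof.
  repeat split.
  - intros z Hz. apply (ex_usum_wp_term_lattice w1 w2); auto; [intros w []; auto|].
    apply (far_sub _ (lattice w1 w2)); [intros w []; auto | now apply not_lattice_far].
  - intros z. destruct (classic (lattice w1 w2 z)) as [Hz|Hz].
    + right. split; [exists 2%nat; now apply pole_wp | now apply wp_infty].
    + left. now apply holomorphic_at_wp.
  - apply wp_periodic; auto; [apply lattice_l | now apply half_periods_notin_lattice].
  - apply wp_periodic; auto; [apply lattice_r | now apply half_periods_notin_lattice].
  (* [repeat split] also opened [pole_of_order], leaving its order condition [1 <= 2] as a separate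
     goal. *)
  - lia.
  - now apply pole_wp.
  - intros z Hz. now apply holomorphic_at_not_pole, holomorphic_at_wp.
  - intros z. now apply wp_even.
Qed.
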